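(* Let $X$ be a Banach space and let $0\le\nu\le 1$. Then $1\le H_\nu(X,B)\le 2$.
   Context: $S_X$ is the unit sphere of $X$. For $x,y\in X$, $x\perp_B y$ (Birkhoff orthogonality) means $\|x+\lambda y\|\ge\|x\|$ for all real $\lambda$. For $0\le\nu\le1$, $$H_\nu(X,B)=\sup\left\{\frac{\|x+y\|^{\nu}\|x-y\|^{1-\nu}+\|x+y\|^{1-\nu}\|x-y\|^{\nu}}{2}:\ x,y\in S_X,\ x\perp_B y\right\}.$$
   Formalization: The Banach space X is assumed to have dimension at least 2; in dimension 0 or 1 no two unit vectors are Birkhoff orthogonal, so the supremum defining H_ν(X,B) is over the empty set and the lower bound fails. *)

(* Defs.v *)
From HB Require Import structures.
From mathcomp Require Import all_boot all_order all_algebra.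
From mathcomp Require Import all_classical all_reals all_analysis.
Import Order.TTheory GRing.Theory Num.Theory.
Import numFieldNormedType.Exports.

Set Implicit Arguments.
Unset Strict Implicit.
Unset Printing Implicit Defensive.

Local Open Scope classical_set_scope.
Local Open Scope ring_scope.

Definition unit_sphere (R : realType) (X : normedModType R) : set X :=
  [set x | `|x| = 1].
Arguments unit_sphere {R} X.

Definition birkhoff_orth (R : realType) (X : normedModType R) (x y : X) : Prop :=
  forall l : R, `|x| <= `|x + l *: y|.

(* In dimension at most 1 no unit vectors are Birkhoff orthogonal, so the
   supremum defining H_const would be taken over the empty set. *)
Definition dim_ge2 (R : realType) (X : lmodType R) : Prop :=
  exists u v : X, forall a b : R, a *: u + b *: v = 0 -> a = 0 /\ b = 0.
Arguments dim_ge2 {R} X.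

Definition H_set (R : realType) (X : normedModType R) (nu : R) : set R :=
  [set r | exists x y : X,
     [/\ unit_sphere X x, unit_sphere X y, birkhoff_orth x y &
         r = (`|x + y| `^ nu * `|x - y| `^ (1 - nu)
              + `|x + y| `^ (1 - nu) * `|x - y| `^ nu) / 2]].
Arguments H_set {R} X nu.

(* The library's [sup] is 0 on an empty or unbounded set; neither occurs when
   [dim_ge2 X] holds and 0 <= nu <= 1. *)
Definition H_const (R : realType) (X : normedModType R) (nu : R) : R :=
  sup (H_set X nu).
Arguments H_const {R} X nu.

(* Main.v *)
Require Import Defs.
From mathcomp Require Import all_boot all_order all_algebra.
From mathcomp Require Import all_classical all_reals all_analysis.
From mathcomp Require Import lra.
Import Order.TTheory GRing.Theory Num.Theory.
Import numFieldNormedType.Exports.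
Local Open Scope ring_scope.

(* Birkhoff orthogonality of unit vectors x, y, applied with l = 1 and l = -1,
   puts both norms |x + y| and |x - y| in [1, 2], so every element of [H_set]
   lies in [1, 2]. It remains to produce one orthogonal pair: for independent
   u, v, let u + t v be a point of the line u + R v closest to the origin; its
   normalization is Birkhoff orthogonal to that of v. *)

(** Powers with nonnegative exponents are monotone in the base and keep bases above 1 above 1; since
    the exponents sum to 1, replacing both bases by 2 gives exactly 2. *)
Lemma powR_mul_1_2 (R : realType) (a b p : R) :
  1 <= a <= 2 -> 1 <= b <= 2 -> 0 <= p <= 1 ->
  1 <= a `^ p * b `^ (1 - p) <= 2.
Proof.
move=> /andP[a1 a2] /andP[b1 b2] /andP[p0 p1].
have q0 : 0 <= 1 - p by rewrite subr_ge0.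
have lb (c q : R) : 1 <= c -> 0 <= q -> 1 <= c `^ q.
  by move=> c1 q0'; rewrite -(powRr0 c) ler_powR.
have ub (c q : R) : 1 <= c -> c <= 2 -> 0 <= q -> c `^ q <= 2 `^ q.
  by move=> c1 c2 q0'; apply: ge0_ler_powR; rewrite ?nnegrE//; lra.
apply/andP; split; first by rewrite mulr_ege1 ?lb.
have -> : 2 = 2 `^ p * 2 `^ (1 - p) :> R.
  by rewrite -powRD ?pnatr_eq0 ?implybT// subrKC powRr1.
by rewrite ler_pM ?powR_ge0 ?ub.
Qed.

Lemma exists_closest_on_line (R : realType) (X : normedModType R) (u v : X) :
  v != 0 -> exists t : R, forall s : R, `|u + t *: v| <= `|u + s *: v|.
Proof.
move=> v0; have nv0 : 0 < `|v| by rewrite normr_gt0.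
pose f (s : R) := `|u + s *: v|.
(* Beyond [M] the vector [s *: v] has norm at least twice that of [u], so the reverse triangle
   inequality gives [f s >= f 0]; a minimum over the compact interval from [- M] to [M] is thus
   global. *)
pose M := 2 * `|u| / `|v|.
have M0 : 0 <= M by rewrite /M divr_ge0 ?mulr_ge0.
have cf : continuous f.
  move=> s; apply: cvg_norm; apply: cvgD; first exact: cvg_cst.
  by apply: cvgZr_tmp; exact: cvg_id.
have [|t _ tmin] := @EVT_min R f (- M) M _ (continuous_subspaceT cf).
  by rewrite (le_trans _ M0)// oppr_le0.
exists t => s; have [sM|sM] := leP `|s| M.
  by apply: tmin; rewrite in_itv/= -ler_norml.
have f0 : f 0 = `|u| by rewrite /f scale0r addr0.
apply: (@le_trans _ _ (f 0)).
  by apply: tmin; rewrite in_itv/= oppr_le0 M0.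
rewrite f0.
have sv : 2 * `|u| <= `|s *: v|.
  by rewrite normrZ -ler_pdivrMr// ltW.
have := lerB_normD (s *: v) u; rewrite [s *: v + u]addrC; lra.
Qed.

Lemma exists_birkhoff_orth (R : realType) (X : normedModType R) :
  dim_ge2 X ->
  exists x y : X, [/\ unit_sphere X x, unit_sphere X y & birkhoff_orth x y].
Proof.
move=> [u [v uv]].
have v0 : v != 0.
  apply/eqP => v0; have := uv 0 1; rewrite v0 scale0r scaler0 addr0.
  by move=> /(_ erefl)[_ /eqP]; rewrite oner_eq0.
have [t tmin] := exists_closest_on_line _ _ u v v0.
set w := u + t *: v in tmin.
have w0 : w != 0.
  apply/eqP => w0; have := uv 1 t; rewrite scale1r => /(_ w0)[/eqP].
  by rewrite oner_eq0.
have nw0 : 0 < `|w| by rewrite normr_gt0.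
have unit_normalize (z : X) : z != 0 -> `| `|z|^-1 *: z| = 1.
  by move=> z0; rewrite normrZ normfV normr_id mulVf// normr_eq0.
exists (`|w|^-1 *: w), (`|v|^-1 *: v).
split; [exact: unit_normalize|exact: unit_normalize|move=> l].
rewrite unit_normalize//.
(* Up to the factor [|w|^-1], the perturbed vector is again a point of the line through [u] directed
   by [v], where [tmin] applies. *)
have -> : `|w|^-1 *: w + l *: (`|v|^-1 *: v)
        = `|w|^-1 *: (u + (t + `|w| * l / `|v|) *: v).
  rewrite scalerDl addrA -/w [RHS]scalerDr; congr (_ + _); rewrite !scalerA.
  by congr (_ *: _); rewrite !mulrA mulVf ?mul1r// gt_eqF.
by rewrite normrZ normfV normr_id mulrC ler_pdivlMr// mul1r.
Qed.

Lemma H_set_bounds (R : realType) (X : normedModType R) (nu r : R) :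
  0 <= nu <= 1 -> H_set X nu r -> 1 <= r <= 2.
Proof.
move=> nu01 [x [y [x1 y1 xy ->]]]; rewrite /unit_sphere/= in x1 y1.
have D : 1 <= `|x + y| <= 2.
  have := xy 1; have := ler_normD x y; rewrite scale1r x1 y1; lra.
have B : 1 <= `|x - y| <= 2.
  have := xy (-1); have := ler_normB x y; rewrite scaleN1r x1 y1; lra.
have := powR_mul_1_2 _ _ _ _ D B nu01.
(* The second summand is the first with the two norms exchanged. *)
have := powR_mul_1_2 _ _ _ _ B D nu01.
rewrite [`|x - y| `^ _ * _]mulrC; lra.
Qed.

Theorem proposition3p1 (R : realType) (X : completeNormedModType R)
    (hX : dim_ge2 X) (nu : R) (hnu : 0 <= nu <= 1) :
  1 <= H_const X nu <= 2.
Proof.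
have [x [y [x1 y1 xy]]] := exists_birkhoff_orth _ _ hX.
pose r := (`|x + y| `^ nu * `|x - y| `^ (1 - nu)
           + `|x + y| `^ (1 - nu) * `|x - y| `^ nu) / 2.
(* This one element both makes the set nonempty, as the upper bound on [sup] requires, and bounds
   [sup] from below by 1. *)
have Hr : H_set X nu r by exists x, y.
have ub2 : ubound (H_set X nu) 2.
  by move=> s /(H_set_bounds _ _ _ _ hnu)/andP[].
have /andP[r1 _] := H_set_bounds _ _ _ _ hnu Hr.
apply/andP; split; last by apply: ge_sup => //; exists r.
by apply: (le_trans r1); apply: ub_le_sup => //; exists 2.
Qed.
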